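(* (i) For each free filter $\mathscr{F}$ on $\mathbb{N}$ the topological semilattices $\mathbb{N}_{\mathscr{F},\min}$ and $\mathbb{N}_{\mathscr{F},\max}$ are $\mathscr{AH}$-complete. (ii) Each $\mathscr{H}$-completion of the discrete semilattice $(\mathbb{N},\min)$ (resp., $(\mathbb{N},\max)$) is topologically isomorphic to the topological semilattice $\mathbb{N}_{\mathscr{F},\min}$ (resp., $\mathbb{N}_{\mathscr{F},\max}$) for some free filter $\mathscr{F}$ on $\mathbb{N}$. (iii) The discrete topological semilattice $(\mathbb{N},\min)$ (resp., $(\mathbb{N},\max)$) has no universal $\mathscr{AH}$-completion.
   Context: All topological spaces are assumed to be Hausdorff. $\mathbb{N}$ is the set of positive integers. A topological semigroup is a (Hausdorff) topological space with a continuous (jointly, as a map $S\times S\to S$) associative operation. A semilattice is a set with a commutative, idempotent, associative operation; a topological semilattice is a topological semigroup which is algebraically a semilattice. A topological isomorphism is a semigroup isomorphism that is a homeomorphism. Completeness. A topological semigroup $X$ is $\mathscr{H}$-complete if for every Hausdorff topological semigroup $Y$ and every homomorphism $f\colon X\to Y$ that is a topological embedding, $f(X)$ is closed in $Y$. $X$ is $\mathscr{AH}$-complete if for every Hausdorff topological semigroup $Y$ and every continuous homomorphism $f\colon X\to Y$, $f(X)$ is closed in $Y$. An $\mathscr{H}$-completion (resp. $\mathscr{AH}$-completion) of a topological semigroup $X$ is an $\mathscr{H}$-complete (resp. $\mathscr{AH}$-complete) Hausdorff topological semigroup $\widetilde{X}$ containing $X$ as a dense subsemigroup (with the subspace topology).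 An $\mathscr{AH}$-completion $\widetilde{X}$ of $X$ is universal if each continuous homomorphism $h\colon X\to Y$ to an $\mathscr{AH}$-complete topological semigroup $Y$ extends to a continuous homomorphism $\tilde h\colon\widetilde{X}\to Y$. The spaces $\mathbb{N}_{\mathscr{F}}$. A (proper) filter $\mathscr{F}$ on $\mathbb{N}$ is free if $\bigcap\mathscr{F}=\varnothing$. For a free filter $\mathscr{F}$ on $\mathbb{N}$, $\mathbb{N}_{\mathscr{F}}=\mathbb{N}\cup\{\mathscr{F}\}$ is the topological space in which all points of $\mathbb{N}$ are isolated and the sets $F\cup\{\mathscr{F}\}$, $F\in\mathscr{F}$, form a neighbourhood base at the point $\mathscr{F}$. $\mathbb{N}_{\mathscr{F},\min}$ is this space with the operation extending $\min$ on $\mathbb{N}$ by $\min\{n,\mathscr{F}\}=\min\{\mathscr{F},n\}=n$ for $n\in\mathbb{N}$ and $\min\{\mathscr{F},\mathscr{F}\}=\mathscr{F}$. $\mathbb{N}_{\mathscr{F},\max}$ is this space with the operation extending $\max$ on $\mathbb{N}$ by $\max\{n,\mathscr{F}\}=\max\{\mathscr{F},n\}=\max\{\mathscr{F},\mathscr{F}\}=\mathscr{F}$ for $n\in\mathbb{N}$. Both are topological semilattices. *)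

(* Defs.v *)
From HB Require Import structures.
From mathcomp Require Import all_boot.
From mathcomp Require Import all_classical topology.

Set Implicit Arguments.
Unset Strict Implicit.
Unset Printing Implicit Defensive.

Local Open Scope classical_set_scope.

(* All spaces are Hausdorff, so the Hausdorff axiom is part of the structure. *)
HB.mixin Record isTopSemigroup S of Topological S & Semigroup S := {
  mulg_continuous : continuous (fun p : S * S => (p.1 * p.2)%g);
  topsemigroup_hausdorff : hausdorff_space S
}.

#[short(type="topSemigroupType")]
HB.structure Definition TopSemigroup :=
  {S of Topological S & Semigroup S & isTopSemigroup S}.

HB.mixin Record isSemilattice S of Magma S := {
  semilattice_mulC : forall x y : S, (x * y)%g = (y * x)%g;
  semilattice_mulxx : forall x : S, (x * x)%g = x
}.

#[short(type="topSemilatticeType")]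
HB.structure Definition TopSemilattice :=
  {S of TopSemigroup S & isSemilattice S}.

Definition homomorphism (X Y : semigroupType) (f : X -> Y) : Prop :=
  {morph f : x y / (x * y)%g}.

Definition topological_embedding (X Y : topologicalType) (f : X -> Y) : Prop :=
  injective f /\
  forall U : set X, open U <-> exists2 V : set Y, open V & U = f @^-1` V.

Definition topologically_isomorphic (X Y : topSemigroupType) : Prop :=
  exists (f : X -> Y) (g : Y -> X),
    [/\ cancel f g, cancel g f, homomorphism f, continuous f & continuous g].

Definition H_complete (X : topSemigroupType) : Prop :=
  forall (Y : topSemigroupType) (f : X -> Y),
    homomorphism f -> topological_embedding f -> closed (range f).

Definition AH_complete (X : topSemigroupType) : Prop :=
  forall (Y : topSemigroupType) (f : X -> Y),
    homomorphism f -> continuous f -> closed (range f).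

(* A completion containing X as a dense subsemigroup is given with its
   inclusion map i, an embedding both algebraically and topologically. *)
Definition H_completion (X Xt : topSemigroupType) (i : X -> Xt) : Prop :=
  [/\ H_complete Xt, homomorphism i, topological_embedding i
    & dense (range i)].

Definition AH_completion (X Xt : topSemigroupType) (i : X -> Xt) : Prop :=
  [/\ AH_complete Xt, homomorphism i, topological_embedding i
    & dense (range i)].

Definition universal_AH_completion (X Xt : topSemigroupType) (i : X -> Xt) :
    Prop :=
  AH_completion i /\
  forall (Y : topSemigroupType) (h : X -> Y),
    AH_complete Y -> homomorphism h -> continuous h ->
    exists ht : Xt -> Y,
      [/\ homomorphism ht, continuous ht & forall x, ht (i x) = h x].

Definition posnat : Type := {n : nat | 0 < n}.
HB.instance Definition _ := Choice.on posnat.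

Lemma minp_subproof (m n : posnat) : 0 < minn (val m) (val n).
Proof. by rewrite leq_min (valP m) (valP n). Qed.
Lemma maxp_subproof (m n : posnat) : 0 < maxn (val m) (val n).
Proof. by rewrite leq_max (valP m). Qed.

Definition minp (m n : posnat) : posnat := Sub _ (minp_subproof m n).
Definition maxp (m n : posnat) : posnat := Sub _ (maxp_subproof m n).

Lemma minpA : associative minp.
Proof. by move=> m n p; apply: val_inj; rewrite /= minnA. Qed.
Lemma minpC : commutative minp.
Proof. by move=> m n; apply: val_inj; rewrite /= minnC. Qed.
Lemma minpp : idempotent_op minp.
Proof. by move=> m; apply: val_inj; rewrite /= minnn. Qed.
Lemma maxpA : associative maxp.
Proof. by move=> m n p; apply: val_inj; rewrite /= maxnA. Qed.
Lemma maxpC : commutative maxp.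
Proof. by move=> m n; apply: val_inj; rewrite /= maxnC. Qed.
Lemma maxpp : idempotent_op maxp.
Proof. by move=> m; apply: val_inj; rewrite /= maxnn. Qed.
Lemma minp_l (m n : posnat) : val m <= val n -> minp m n = m.
Proof. by move=> mn; apply: val_inj; apply/minn_idPl. Qed.
Lemma maxp_r (m n : posnat) : val m <= val n -> maxp m n = n.
Proof. by move=> mn; apply: val_inj; apply/maxn_idPr. Qed.
Lemma minp_or (m n : posnat) : minp m n = m \/ minp m n = n.
Proof.
by case: (leqP (val m) (val n)) => [|/ltnW] /minp_l; [left|rewrite minpC; right].
Qed.
Lemma maxp_or (m n : posnat) : maxp m n = m \/ maxp m n = n.
Proof.
by case: (leqP (val m) (val n)) => [|/ltnW] /maxp_r; [right|rewrite maxpC; left].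
Qed.

(* N_min and N_max are aliases of the discrete space of positive integers
   carrying the two different operations. *)
Definition N_min : Type := discrete_topology posnat.
Definition N_max : Type := discrete_topology posnat.

HB.instance Definition _ := DiscreteTopology.on N_min.
HB.instance Definition _ := isSemigroup.Build N_min minpA.
HB.instance Definition _ := DiscreteTopology.on N_max.
HB.instance Definition _ := isSemigroup.Build N_max maxpA.

Lemma discrete_continuous2 (T : discreteTopologicalType) (op : T -> T -> T) :
  continuous (fun p : T * T => op p.1 p.2).
Proof.
move=> [x y] U /nbhs_singleton /= Uxy; exists ([set x], [set y]) => /=.
  by split; rewrite nbhs_principalE; apply/principal_filterP.
by move=> [a b] [/= -> ->].
Qed.

HB.instance Definition _ := isTopSemigroup.Build N_min
  (@discrete_continuous2 N_min minp) (@discrete_hausdorff N_min).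
HB.instance Definition _ := isTopSemigroup.Build N_max
  (@discrete_continuous2 N_max maxp) (@discrete_hausdorff N_max).
HB.instance Definition _ := isSemilattice.Build N_min minpC minpp.
HB.instance Definition _ := isSemilattice.Build N_max maxpC maxpp.

Record freeFilter := FreeFilter {
  free_sets :> set_system posnat;
  free_proper : ProperFilter free_sets;
  free_bigcap : \bigcap_(A in free_sets) A = set0
}.
#[global] Existing Instance free_proper.

(* The space N_F: None is the added point F, and Some n is the integer n. *)
Definition N_adj (F : freeFilter) : Type := option posnat.

Section NAdj.
Variable F : freeFilter.
Local Notation T := (N_adj F).

Definition N_adj_nbhs (x : T) : set_system T :=
  match x with
  | Some n => principal_filter (Some n)
  | None => filter_from (free_sets F) (fun A : set posnat => Some @` A `|` [set None])
  end.

HB.instance Definition _ := Choice.copy T (option posnat).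
HB.instance Definition _ := hasNbhs.Build T N_adj_nbhs.

Lemma nbhs_SomeE (n : posnat) (A : set T) :
  nbhs (Some n : T) A <-> A (Some n).
Proof. by split=> /principal_filterP. Qed.

Lemma nbhs_NoneE (A : set T) :
  nbhs (None : T) A <-> A None /\ free_sets F (Some @^-1` A).
Proof.
split=> [[B FB BA]|[AN FA]].
  by split; [apply: BA; right|apply: filterS FB => n Bn; apply: BA; left; exists n].
by exists (Some @^-1` A) => // x [[n An <-]|->].
Qed.

Lemma N_adj_nbhs_filter (x : T) : ProperFilter (nbhs x).
Proof.
case: x => [n|]; first exact: principal_filter_proper.
split; first by move=> /nbhs_NoneE[].
split.
- by apply/nbhs_NoneE; split => //; apply: filterT.
- move=> A B /nbhs_NoneE[AN FA] /nbhs_NoneE[BN FB].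
  by apply/nbhs_NoneE; split => //; apply: filterI FA FB.
- move=> A B AB /nbhs_NoneE[AN FA]; apply/nbhs_NoneE.
  by split; [exact: AB|apply: filterS FA => n; exact: AB].
Qed.

Lemma N_adj_nbhs_singleton (x : T) (A : set T) : nbhs x A -> A x.
Proof. by case: x => [n /nbhs_SomeE|/nbhs_NoneE[]]. Qed.

Lemma N_adj_nbhs_nbhs (x : T) (A : set T) : nbhs x A -> nbhs x (nbhs^~ A).
Proof.
case: x => [n nA|NA]; first exact/nbhs_SomeE.
apply/nbhs_NoneE; split=> //; have /nbhs_NoneE[_] := NA.
by apply: filterS => n An; apply/nbhs_SomeE.
Qed.

HB.instance Definition _ := @Nbhs_isNbhsTopological.Build T
  N_adj_nbhs_filter N_adj_nbhs_singleton N_adj_nbhs_nbhs.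

Lemma free_gt (m : nat) : free_sets F [set k : posnat | m < val k].
Proof.
elim: m => [|m IH]; first by apply: filterS (@filterT _ (free_sets F) _) => k _; exact: valP k.
have Fm1 : free_sets F [set k : posnat | val k != m.+1].
  pose j : posnat := Sub m.+1 (ltn0Sn m).
  have : ~ (\bigcap_(A in free_sets F) A) j by rewrite free_bigcap.
  move=> /existsNP[A /not_implyP[FA nAj]].
  apply: filterS FA => k Ak; apply/eqP => kj; apply: nAj.
  by rewrite (_ : j = k)//; apply: val_inj.
apply: filterS (filterI IH Fm1) => k [/= mk km].
by rewrite ltn_neqAle eq_sym km.
Qed.

Lemma nbhs_None_gt (m : posnat) :
  nbhs (None : T) [set x | if x is Some k then val m < val k else true].
Proof. by apply/nbhs_NoneE; split => //; apply: free_gt. Qed.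

Lemma N_adj_hausdorff : hausdorff_space T.
Proof.
have sep (m : posnat) : ~ cluster (nbhs (Some m : T)) None.
  move=> /(_ _ _ (proj2 (nbhs_SomeE m [set Some m]) erefl) (nbhs_None_gt m)).
  by move=> [_ [/= ->]]; rewrite ltnn.
move=> [m|] [n|] // c.
- have [//= x [-> //]] := c _ _ (proj2 (nbhs_SomeE m [set Some m]) erefl)
    (proj2 (nbhs_SomeE n [set Some n]) erefl).
- by case: (sep m).
- by case: (sep n) => A B nA nB; rewrite setIC; apply: c.
Qed.

Lemma N_adj_continuous2 (op : T -> T -> T) :
  commutative op -> (forall x y, op x y = x \/ op x y = y) ->
  (forall m : posnat, nbhs (op (Some m) None) `<=`
     (fun U => \forall y \near (None : T), U (op (Some m) y))) ->
  continuous (fun p : T * T => op p.1 p.2).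
Proof.
move=> opC op_or opN [[m|] [n|]] U /= nU.
- exists ([set Some m], [set Some n]) => /=; first by split; apply/nbhs_SomeE.
  by move=> [a b] [/= -> ->]; exact: nbhs_singleton nU.
- exists ([set Some m], [set y | U (op (Some m) y)]) => /=.
    by split; [exact/nbhs_SomeE|exact: opN].
  by move=> [a b] [/= ->].
- exists ([set y | U (op (Some n) y)], [set Some n]) => /=.
    by split; [apply: opN; rewrite opC|exact/nbhs_SomeE].
  by move=> [a b] [/= + ->]; rewrite opC.
- have opNN : op None None = None by case: (op_or None None).
  rewrite opNN in nU; exists (U, U) => // -[a b] [/= Ua Ub].
  by case: (op_or a b) => ->.
Qed.

End NAdj.

Definition min_adj (F : freeFilter) (x y : N_adj F) : N_adj F :=
  match x, y with
  | Some m, Some n => Some (minp m n)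
  | Some m, None => Some m
  | None, Some n => Some n
  | None, None => None
  end.

Definition max_adj (F : freeFilter) (x y : N_adj F) : N_adj F :=
  match x, y with
  | Some m, Some n => Some (maxp m n)
  | _, _ => None
  end.

Section MinMaxAdj.
Variable F : freeFilter.

Lemma min_adjA : associative (@min_adj F).
Proof. by move=> [m|] [n|] [p|] //=; rewrite minpA. Qed.
Lemma min_adjC : commutative (@min_adj F).
Proof. by move=> [m|] [n|] //=; rewrite minpC. Qed.
Lemma min_adjxx : idempotent_op (@min_adj F).
Proof. by move=> [m|] //=; rewrite minpp. Qed.
Lemma max_adjA : associative (@max_adj F).
Proof. by move=> [m|] [n|] [p|] //=; rewrite maxpA. Qed.
Lemma max_adjC : commutative (@max_adj F).
Proof. by move=> [m|] [n|] //=; rewrite maxpC. Qed.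
Lemma max_adjxx : idempotent_op (@max_adj F).
Proof. by move=> [m|] //=; rewrite maxpp. Qed.

Lemma min_adj_continuous :
  continuous (fun p : N_adj F * N_adj F => min_adj p.1 p.2).
Proof.
apply: N_adj_continuous2 => [|x y|m U /= /nbhs_SomeE Um].
- exact: min_adjC.
- by move: x y => [m|] [n|] /=; auto; case: (minp_or m n) => ->; auto.
- apply: filterS (nbhs_None_gt F m) => -[k|_] //= /ltnW mk.
  by rewrite minp_l.
Qed.

Lemma max_adj_continuous :
  continuous (fun p : N_adj F * N_adj F => max_adj p.1 p.2).
Proof.
apply: N_adj_continuous2 => [|x y|m U /= UN].
- exact: max_adjC.
- by move: x y => [m|] [n|] /=; auto; case: (maxp_or m n) => ->; auto.
- apply: filterS (filterI UN (nbhs_None_gt F m)) => -[k|] [] //= Uk /ltnW mk.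
  by rewrite maxp_r.
Qed.

End MinMaxAdj.

Definition N_adj_min (F : freeFilter) : Type := N_adj F.
Definition N_adj_max (F : freeFilter) : Type := N_adj F.

HB.instance Definition _ (F : freeFilter) := Topological.copy (N_adj_min F) (N_adj F).
HB.instance Definition _ (F : freeFilter) :=
  isSemigroup.Build (N_adj_min F) (@min_adjA F).
HB.instance Definition _ (F : freeFilter) :=
  isTopSemigroup.Build (N_adj_min F) (@min_adj_continuous F) (@N_adj_hausdorff F).
HB.instance Definition _ (F : freeFilter) :=
  isSemilattice.Build (N_adj_min F) (@min_adjC F) (@min_adjxx F).

HB.instance Definition _ (F : freeFilter) := Topological.copy (N_adj_max F) (N_adj F).
HB.instance Definition _ (F : freeFilter) :=
  isSemigroup.Build (N_adj_max F) (@max_adjA F).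
HB.instance Definition _ (F : freeFilter) :=
  isTopSemigroup.Build (N_adj_max F) (@max_adj_continuous F) (@N_adj_hausdorff F).
HB.instance Definition _ (F : freeFilter) :=
  isSemilattice.Build (N_adj_max F) (@max_adjC F) (@max_adjxx F).

(* Main.v *)
(* A point y of the closure of a copy g of (N, min) or (N, max), outside the
   copy itself, lies in the closure of every tail of g. Letting k tend to y in
   min (n, k) = n, resp. max (n, k) = k, makes y an identity, resp. a zero, for
   g, and two such points multiply to each of them, so y is unique. Hence the
   closure of g adds at most one point, which gives (i), and (ii) follows since
   the discrete semilattice is not closed in N_F. For (iii), a universal
   completion would map continuously to N_G for a filter G containing the even
   numbers and for one containing the odd numbers. Both maps send the added
   point to infinity, so the preimages of the even and of the odd numbers would
   intersect inside N. *)
Require Import Defs.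
From HB Require Import structures.
From mathcomp Require Import all_boot.
From mathcomp Require Import all_classical topology.

Set Implicit Arguments.
Unset Strict Implicit.
Unset Printing Implicit Defensive.

Local Open Scope classical_set_scope.

(** * Adherent points and tails of a sequence in a Hausdorff space *)

Lemma hausdorff_eq_closure (X Y : topologicalType) (f g : X -> Y) (A : set X) :
  hausdorff_space Y -> continuous f -> continuous g ->
  (forall x, A x -> f x = g x) -> forall x, closure A x -> f x = g x.
Proof.
move=> hY cf cg fg x Ax; apply: hY => U V fU gV.
have nU : nbhs x (f @^-1` U) by exact: cf.
have nV : nbhs x (g @^-1` V) by exact: cg.
have [a [Aa [/= Ua Va]]] := Ax _ (filterI nU nV).
by exists (f a); split => //; rewrite fg.
Qed.

Lemma hausdorff_closed_set1 (T : topologicalType) (x : T) :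
  hausdorff_space T -> closed [set x].
Proof. by move=> /hausdorff_accessible/accessible_closed_set1; apply. Qed.

Lemma closureU1_neq (T : topologicalType) (A : set T) (c y : T) :
  hausdorff_space T -> closure (A `|` [set c]) y -> y <> c -> closure A y.
Proof.
move=> hT; rewrite closureU => -[//|].
by have /closure_id <- := @hausdorff_closed_set1 _ c hT.
Qed.

(** Each induction step strips the single value [g j], [j = m + 1]. It differs from [y] and points
    are closed, so [y] stays adherent to what is left. *)
Lemma closure_tail (T : topologicalType) (g : posnat -> T) (y : T) :
  hausdorff_space T -> closure (range g) y -> ~ range g y ->
  forall m : nat, closure (g @` [set k | m < val k]) y.
Proof.
move=> hT cy ny; elim=> [|m IH].
  by apply: closureS cy => _ [k _ <-]; exists k => //; exact: valP k.
pose j : posnat := Sub m.+1 (ltn0Sn m).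
apply: (closureU1_neq (c := g j)) => //; last by move=> yj; apply: ny; exists j.
apply: closureS IH => _ [k /= mk <-].
have [/val_inj ->|kj] := eqVneq (val k) (val j); first by right.
by left; exists k => //=; rewrite ltn_neqAle eq_sym kj.
Qed.

(** * Points adherent to a copy of N under min or max in a topological semigroup *)

Section TopSemigroup.
Variable S : topSemigroupType.
Local Open Scope group_scope.

Lemma mull_continuous (a : S) : continuous (fun x : S => a * x).
Proof.
move=> x; apply: (@continuous2_cvg _ S S S _ _ (fun=> a) id (fun a b => a * b)).
- exact: (@mulg_continuous S (a, x)).
- exact: cvg_cst.
- exact: cvg_id.
Qed.

Lemma mulr_continuous (a : S) : continuous (fun x : S => x * a).
Proof.
move=> x; apply: (@continuous2_cvg _ S S S _ _ id (fun=> a) (fun a b => a * b)).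
- exact: (@mulg_continuous S (x, a)).
- exact: cvg_id.
- exact: cvg_cst.
Qed.

Variable g : posnat -> S.
Let hS : hausdorff_space S := @topsemigroup_hausdorff S.
Let cst_continuous (a : S) : continuous (fun _ : S => a).
Proof. by move=> x; exact: cvg_cst. Qed.
Let id_continuous : continuous (fun x : S => x).
Proof. by move=> x; exact: cvg_id. Qed.

Lemma min_adherent_id y : (forall a b, g (minp a b) = g a * g b) ->
  closure (range g) y -> ~ range g y ->
  forall n, g n * y = g n /\ y * g n = g n.
Proof.
move=> gM cy ny n; have ty := closure_tail hS cy ny (val n).
split.
- apply: (hausdorff_eq_closure hS (@mull_continuous (g n))
    (@cst_continuous (g n)) _ ty) => _ [k /ltnW nk <-].
  by rewrite -gM minp_l.
- apply: (hausdorff_eq_closure hS (@mulr_continuous (g n))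
    (@cst_continuous (g n)) _ ty) => _ [k /ltnW nk <-].
  by rewrite -gM minpC minp_l.
Qed.

Lemma max_adherent_zero y : (forall a b, g (maxp a b) = g a * g b) ->
  closure (range g) y -> ~ range g y ->
  forall n, g n * y = y /\ y * g n = y.
Proof.
move=> gM cy ny n; have ty := closure_tail hS cy ny (val n).
split.
(* The comparison is with the identity map, not a constant one: [g n * g k = g k] on the tail
   [k > n]. *)
- apply: (hausdorff_eq_closure hS (@mull_continuous (g n))
    id_continuous _ ty) => _ [k /ltnW nk <-].
  by rewrite -gM maxp_r.
- apply: (hausdorff_eq_closure hS (@mulr_continuous (g n))
    id_continuous _ ty) => _ [k /ltnW nk <-].
  by rewrite -gM maxpC maxp_r.
Qed.

(** The product [z * y] is evaluated twice: [z * x = x] extends from the range to [x = y], and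
    [x * y = x] extends to [x = z]. *)
Lemma adherent_id_unique y z : closure (range g) y -> closure (range g) z ->
  (forall n, g n * y = g n) -> (forall n, z * g n = g n) -> y = z.
Proof.
move=> cy cz gy zg; transitivity (z * y).
  apply/esym; apply: (hausdorff_eq_closure hS (@mull_continuous z)
    id_continuous _ cy) => _ [n _ <-]; exact: zg.
apply: (hausdorff_eq_closure hS (@mulr_continuous y)
    id_continuous _ cz) => _ [n _ <-]; exact: gy.
Qed.

(** Again [z * y] is evaluated twice: [x * y = y] extends from the range to [x = z], and [z * x = z]
    extends to [x = y]. *)
Lemma adherent_zero_unique y z : closure (range g) y -> closure (range g) z ->
  (forall n, g n * y = y) -> (forall n, z * g n = z) -> y = z.
Proof.
move=> cy cz gy zg; transitivity (z * y).
  apply/esym; apply: (hausdorff_eq_closure hS (@mulr_continuous y)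
    (@cst_continuous y) _ cz) => _ [n _ <-]; exact: gy.
apply: (hausdorff_eq_closure hS (@mull_continuous z)
    (@cst_continuous z) _ cy) => _ [n _ <-]; exact: zg.
Qed.

End TopSemigroup.

(** * AH-completeness of the one-point extensions *)

Lemma closure_N_adj (F : freeFilter) (Y : topologicalType) (f : N_adj F -> Y) :
  continuous f -> closure (range (fun n : posnat => f (Some n))) (f None).
Proof.
move=> cf B /cf /nbhs_NoneE[_] /filter_ex[n Bn].
by exists (f (Some n)); split => //; exists n.
Qed.

Lemma closed_range_N_adj (F : freeFilter) (Y : topologicalType)
    (f : N_adj F -> Y) : hausdorff_space Y ->
  (forall y, closure (range (fun n : posnat => f (Some n))) y ->
     ~ range (fun n : posnat => f (Some n)) y -> y = f None) ->
  closed (range f).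
Proof.
move=> hY fP y cy; apply: contrapT => ny.
apply: (ny); exists None => //; apply/esym/fP; last first.
  by move=> [n _ fy]; apply: ny; exists (Some n).
apply: (closureU1_neq (c := f None)) => //; last first.
  by move=> yN; apply: ny; exists None.
by apply: closureS cy => _ [[n|] _ <-]; [left; exists n|right].
Qed.

Lemma AH_complete_N_adj_min (F : freeFilter) : AH_complete (N_adj_min F).
Proof.
move=> Y f fM cf.
apply: closed_range_N_adj; first exact: topsemigroup_hausdorff.
move=> y cy ny.
have gM a b : f (Some (minp a b)) = (f (Some a) * f (Some b))%g by rewrite -fM.
apply: (adherent_id_unique cy (closure_N_adj cf)) => n.
- by have [] := min_adherent_id gM cy ny n.
(* [None] is the identity of [N_adj_min F], so [f None] fixes every [f (Some n)]. *)
- exact: (esym (fM None (Some n))).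
Qed.

Lemma AH_complete_N_adj_max (F : freeFilter) : AH_complete (N_adj_max F).
Proof.
move=> Y f fM cf.
apply: closed_range_N_adj; first exact: topsemigroup_hausdorff.
move=> y cy ny.
have gM a b : f (Some (maxp a b)) = (f (Some a) * f (Some b))%g by rewrite -fM.
apply: (adherent_zero_unique cy (closure_N_adj cf)) => n.
- by have [] := max_adherent_zero gM cy ny n.
(* [None] is the zero of [N_adj_max F], so [f None] absorbs every [f (Some n)]. *)
- exact: (esym (fM None (Some n))).
Qed.

(** * Free filters concentrated on the odd or on the even numbers *)

Section ParityFilter.
Variable b : bool.

(** This is the filter generated by the cofinite sets and the set of numbers of parity [b]. *)
Definition parity_sets : set_system posnat :=
  [set A | exists m, forall k : posnat, m < val k -> odd (val k) = b -> A k].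

Lemma parity_proper : ProperFilter parity_sets.
Proof.
split.
  (* This [k] has parity [b] and exceeds [m]; the added 2 makes its positivity hold by
     computation. *)
  move=> [m mP]; pose k := (m.*2.+2 + b)%N.
  apply: (mP (Sub k isT : posnat)); rewrite /= /k.
    by rewrite addSn ltnS -addnn -addnS -addnA leq_addr.
  by rewrite oddD /= negbK odd_double; case: b.
split.
- by exists 0.
- move=> A B [m mA] [n nB]; exists (maxn m n) => k.
  by rewrite gtn_max => /andP[mk nk] kb; split; [exact: mA|exact: nB].
- by move=> A B AB [m mA]; exists m => k mk kb; exact/AB/mA.
Qed.

Lemma parity_bigcap : \bigcap_(A in parity_sets) A = set0.
Proof.
(* The tail strictly beyond [k] belongs to the filter and omits [k]. *)
apply/seteqP; split => // k /(_ [set j | val k < val j]) kk.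
by have /= := kk (ex_intro _ (val k) (fun j kj _ => kj)); rewrite ltnn.
Qed.

Definition parity_filter : freeFilter := FreeFilter parity_proper parity_bigcap.

End ParityFilter.

(** * Extensions of the discrete space N *)

Lemma open_set1_dense (X : topologicalType) (i : posnat -> X) (n : posnat)
    (V : set X) : hausdorff_space X -> dense (range i) -> open V ->
  [set n] = i @^-1` V -> open [set i n].
Proof.
move=> hX di oV Vn; suff -> : [set i n] = V by [].
have Vin k : V (i k) -> k = n by rewrite -[V _]/((i @^-1` V) k) -Vn.
apply/seteqP; split=> [_ ->|x Vx]; first by rewrite -[V _]/((i @^-1` V) n) -Vn.
(* A second point of [V] would make [V] minus [i n] a nonempty open set that misses the dense range
   of [i]. *)
apply: contrapT => xn.
have oW : open (V `&` ~` [set i n]).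
  apply: openI => //; apply: closed_openC.
  exact: hausdorff_closed_set1.
have [|z [[Vj nj] [j _ ji]]] := di _ _ oW; first by exists x.
by move: Vj nj; rewrite -ji => /Vin -> /=.
Qed.

(* The embedding N -> N_F rules out surjective H-completions of N. *)
Lemma discrete_embedding_not_closed (X : topologicalType) (i : posnat -> X)
    (F : freeFilter) (f : X -> N_adj F) :
  (forall n, open [set i n]) -> range i = setT ->
  (forall n, f (i n) = Some n) ->
  topological_embedding f /\ ~ closed (range f).
Proof.
move=> oi iT fi.
have iE x : exists n, i n = x.
  by have : range i x; [rewrite iT|move=> [n]; exists n].
have openX (U : set X) : open U.
  rewrite (_ : U = \bigcup_(n in i @^-1` U) [set i n]).
    by apply: bigcup_open => n _.
  apply/seteqP; split=> [x|x [n Un ->] //].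
  by have [n <-] := iE x => Un; exists n.
split.
  split=> [x y|U].
    by have [n <-] := iE x; have [m <-] := iE y; rewrite !fi => -[->].
  split=> // _; exists (f @` U).
    rewrite openE => _ [x Ux <-]; have [n nx] := iE x.
    by rewrite -nx fi; apply/nbhs_SomeE; exists x => //; rewrite -nx.
  apply/seteqP; split=> [x Ux|x [y Uy]]; first by exists x.
  have [n nx] := iE x; have [m my] := iE y.
  by rewrite -nx -my !fi => -[<-]; rewrite my.
move=> /(_ None)[B /nbhs_NoneE[_] /filter_ex[n Bn]|x _].
  by exists (Some n); split => //; exists (i n).
by have [n <-] := iE x; rewrite fi.
Qed.

(** The filter is the trace on N of the neighbourhoods of [y]: it is proper because [y] is adherent
    to the range, and free because points are closed. Away from [y] both spaces have only isolated
    points. *)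
Lemma one_point_extension (X : topologicalType) (i : posnat -> X) (y : X) :
  hausdorff_space X -> injective i -> (forall n, open [set i n]) ->
  closure (range i) y -> ~ range i y -> (forall x, range i x \/ x = y) ->
  exists (F : freeFilter) (f : X -> N_adj F) (g : N_adj F -> X),
    [/\ cancel f g, cancel g f, continuous f, continuous g &
      (forall n, g (Some n) = i n) /\ g None = y].
Proof.
move=> hX ii oi cy ny yP.
pose D : set_system posnat := [set A | nbhs y (i @` A `|` [set y])].
have D_proper : ProperFilter D.
  split.
    rewrite /D /= image_set0 set0U => /cy[z [rz zy]].
    by apply: ny; rewrite -zy.
  split.
  - apply: filterS (@filterT _ (nbhs y) _) => x _.
    by case: (yP x); [left|right].
  - move=> A B DA DB; rewrite /D /=.
    apply: filterS (filterI (DA : nbhs y _) (DB : nbhs y _)) => x.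
    case=> [[[n An nx]|->] [[m Bm mx]|yx]]; try by right.
    by left; exists n => //; split => //; rewrite (ii n m) // nx mx.
  - move=> A B AB; rewrite /D /=.
    apply: filterS => x [[n /AB Bn nx]|->].
      by left; exists n.
    by right.
have D_bigcap : \bigcap_(A in D) A = set0.
  apply/seteqP; split => // n /(_ (~` [set n])); apply => //.
  have : nbhs y (~` [set i n]).
    apply: open_nbhs_nbhs; split; last by move=> yn; apply: ny; exists n.
    by apply: closed_openC; exact: hausdorff_closed_set1.
  apply: filterS => x xn; case: (yP x) => [[m _ mx]|]; last by right.
  by left; exists m => // mn; apply: xn; rewrite -mx mn.
pose F := FreeFilter D_proper D_bigcap.
pose g (o : N_adj F) : X := oapp i y o.
have gS (x : X) : exists o, g o = x.
  by have [[n _ nx]|->] := yP x; [exists (Some n)|exists None].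
have gI : injective g.
  move=> [n|] [m|] //=; first by move=> /ii ->.
  - by move=> ny'; case: ny; exists n.
  - by move=> /esym my'; case: ny; exists m.
have [f fK] := choice gS.
have gK : cancel g f by move=> o; apply: gI.
have fi n : f (i n) = Some n := gK (Some n).
have fy : f y = None := gK None.
exists F, f, g; split => // [x U|[n|] U].
- move=> nU; change (nbhs x (f @^-1` U)); move: nU.
  have [[n _ <-]|->] := yP x.
    rewrite fi => /nbhs_SomeE Un.
    apply: filterS (open_nbhs_nbhs (conj (oi n) (erefl (i n)))) => _ ->.
    by rewrite /= fi.
  rewrite fy => /nbhs_NoneE[UN]; rewrite [free_sets F]/= /D /=.
  apply: filterS => _ [[n Un <-]|->] /=.
    by rewrite fi.
  by rewrite fy.
- by move=> /nbhs_singleton Un; exact/nbhs_SomeE.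
- move=> nU; apply/nbhs_NoneE; split; first exact: nbhs_singleton nU.
  apply: filterS nU => x Ux; case: (yP x) => [[n _ nx]|->]; last by right.
  by left; exists n => //; rewrite -nx in Ux.
Qed.

(* Continuity at y of the extensions to both parity filters gives y
   neighbourhoods meeting range i in even and in odd numbers only. *)
Lemma no_parity_extensions (X : topologicalType) (i : posnat -> X) (y : X) :
  hausdorff_space X -> closure (range i) y -> ~ range i y ->
  ~ (forall b, exists2 h : X -> N_adj (parity_filter b),
       continuous h & forall n, h (i n) = Some n).
Proof.
move=> hX cy ny H.
have nbh b : nbhs y [set x | forall k, x = i k -> odd (val k) = b].
  have [h ch hi] := H b.
  (* If [h y = Some k], then [h] equals [Some k] near [y]; but every neighbourhood of [y] contains
     some [i n] with [n > k]. *)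
  have hy : h y = None.
    case E: (h y) => [k|//].
    have : nbhs y (h @^-1` [set Some k]).
      by apply: ch; rewrite E; exact/nbhs_SomeE.
    move=> /(closure_tail hX cy ny (val k))[_ [[n kn <-]]] /=.
    by rewrite hi => -[nk]; move: kn; rewrite /= nk ltnn.
  have : nbhs (h y) [set x | if x is Some k then odd (val k) = b else True].
    by rewrite hy; apply/nbhs_NoneE; split => //; exists 0.
  move=> /(ch y) nU; change (nbhs y (h @^-1` [set x | if x is Some k
    then odd (val k) = b else True])) in nU.
  by apply: filterS nU => x /= + k xk; rewrite xk hi.
(* The two neighbourhoods share some [i n], whose index is both odd and even. *)
have [_ [[n _ <-] [/(_ n erefl) + /(_ n erefl)]]] :=
  cy _ (filterI (nbh true) (nbh false)).
by move=> ->.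
Qed.

(** * Classification of the H-completions of N *)

Lemma topological_embedding_continuous (X Y : topologicalType) (f : X -> Y) :
  topological_embedding f -> continuous f.
Proof. by move=> [_ fO]; apply/continuousP => V oV; apply/fO; exists V. Qed.

Lemma dense_closure (X : topologicalType) (A : set X) (x : X) :
  dense A -> closure A x.
Proof.
move=> dA B; rewrite nbhsE => -[U [oU Ux] UB].
have [|z [Uz Az]] := dA _ _ oU; first by exists x.
by exists z; split => //; exact: UB.
Qed.

Lemma AH_completion_H (X Xt : topSemigroupType) (i : X -> Xt) :
  AH_completion i -> H_completion i.
Proof.
move=> [Xc iM iE iD]; split => // Y f fM fE.
exact: Xc fM (topological_embedding_continuous fE).
Qed.

Lemma embedding_open_set1 (X : topologicalType)
    (i : discrete_topology posnat -> X) (n : posnat) :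
  hausdorff_space X -> topological_embedding i -> dense (range i) ->
  open [set i n].
Proof.
move=> hX [_ iO] iD; have [+ _] := iO [set n].
by move=> /(_ (discrete_open _))[V oV nV]; exact: open_set1_dense hX iD oV nV.
Qed.

Lemma H_completion_min_proper (X : topSemigroupType) (i : N_min -> X) :
  H_completion i -> exists y, ~ range i y.
Proof.
move=> [Xc iM iE iD]; apply: contrapT => /forallNP iT0.
have iT x : exists n, i n = x by have /contrapT[n _ <-] := iT0 x; exists n.
have [f fK] := choice iT.
have fi n : f (i n) = n by apply: iE.1.
(* Any free filter would serve: if [i] were onto, [X] would be a discrete copy of N, embedded in
   [N_adj_min F] with non-closed range. *)
pose F := parity_filter true.
have [] := @discrete_embedding_not_closed X i F (fun x => Some (f x)).
- by move=> n; apply: embedding_open_set1 => //; exact: topsemigroup_hausdorff.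
- by apply/seteqP; split => // x _; have [n <-] := iT x; exists n.
- by move=> n; rewrite fi.
move=> fE; apply; apply: (Xc (N_adj_min F)) fE => x y.
by rewrite -[x in LHS]fK -[y in LHS]fK -iM fi.
Qed.

Lemma H_completion_max_proper (X : topSemigroupType) (i : N_max -> X) :
  H_completion i -> exists y, ~ range i y.
Proof.
move=> [Xc iM iE iD]; apply: contrapT => /forallNP iT0.
have iT x : exists n, i n = x by have /contrapT[n _ <-] := iT0 x; exists n.
have [f fK] := choice iT.
have fi n : f (i n) = n by apply: iE.1.
pose F := parity_filter true.
have [] := @discrete_embedding_not_closed X i F (fun x => Some (f x)).
- by move=> n; apply: embedding_open_set1 => //; exact: topsemigroup_hausdorff.
- by apply/seteqP; split => // x _; have [n <-] := iT x; exists n.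
- by move=> n; rewrite fi.
move=> fE; apply; apply: (Xc (N_adj_max F)) fE => x y.
by rewrite -[x in LHS]fK -[y in LHS]fK -iM fi.
Qed.

(** By density every point outside the range of [i] is an adherent identity, so there is exactly
    one, [y], and [X] is a one-point extension. *)
Lemma H_completion_min (X : topSemigroupType) (i : N_min -> X) :
  H_completion i ->
  exists F : freeFilter, topologically_isomorphic X (N_adj_min F).
Proof.
move=> iH; have [y ny] := H_completion_min_proper iH; have [_ iM iE iD] := iH.
have hX := @topsemigroup_hausdorff X.
have iC x : closure (range i) x by exact: dense_closure.
have idP z : ~ range i z -> forall n, (i n * z = i n /\ z * i n = i n)%g.
  exact: min_adherent_id.
have [n|x|F [f [g [fK gK cf cg [gS gN]]]]] :=
  @one_point_extension X i y hX iE.1 _ (iC y) ny.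
- exact: embedding_open_set1.
- have [|nx] := pselect (range i x); [by left|right].
  by apply: (adherent_id_unique (iC x) (iC y)) => n; apply idP.
have gM : {morph g : a b / min_adj a b >-> (a * b)%g}.
  move=> [a|] [b|] /=; rewrite ?gN ?gS.
  - exact: (iM a b).
  - by rewrite (idP y ny a).1.
  - by rewrite (idP y ny b).2.
  (* [y * y] is also an adherent identity, so uniqueness gives [y * y = y]. *)
  - by apply: (adherent_id_unique (iC y) (iC _)) => n;
      rewrite ?mulgA ?(idP y ny n).1 // -mulgA !(idP y ny n).2.
exists F, f, g; split => // a b.
by rewrite -[a in LHS]fK -[b in LHS]fK -gM gK.
Qed.

Lemma H_completion_max (X : topSemigroupType) (i : N_max -> X) :
  H_completion i ->
  exists F : freeFilter, topologically_isomorphic X (N_adj_max F).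
Proof.
move=> iH; have [y ny] := H_completion_max_proper iH; have [_ iM iE iD] := iH.
have hX := @topsemigroup_hausdorff X.
have iC x : closure (range i) x by exact: dense_closure.
have zeroP z : ~ range i z -> forall n, (i n * z = z /\ z * i n = z)%g.
  exact: max_adherent_zero.
have [n|x|F [f [g [fK gK cf cg [gS gN]]]]] :=
  @one_point_extension X i y hX iE.1 _ (iC y) ny.
- exact: embedding_open_set1.
- have [|nx] := pselect (range i x); [by left|right].
  by apply: (adherent_zero_unique (iC x) (iC y)) => n; apply zeroP.
have gM : {morph g : a b / max_adj a b >-> (a * b)%g}.
  move=> [a|] [b|] /=; rewrite ?gN ?gS.
  - exact: (iM a b).
  - by rewrite (zeroP y ny a).1.
  - by rewrite (zeroP y ny b).2.
  (* [y * y] is also an adherent zero, so uniqueness gives [y * y = y]. *)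
  - by apply: (adherent_zero_unique (iC y) (iC _)) => n;
      rewrite ?mulgA ?(zeroP y ny n).1 // -mulgA !(zeroP y ny n).2.
exists F, f, g; split => // a b.
by rewrite -[a in LHS]fK -[b in LHS]fK -gM gK.
Qed.

(** * Nonexistence of universal AH-completions *)

Lemma no_universal_min (X : topSemigroupType) (i : N_min -> X) :
  ~ universal_AH_completion i.
Proof.
move=> [iAH iU]; have iH := AH_completion_H iAH; have [_ _ _ iD] := iH.
have [y ny] := H_completion_min_proper iH.
apply: (no_parity_extensions topsemigroup_hausdorff (dense_closure iD) ny) => b.
have SomeM : @homomorphism N_min (N_adj_min (parity_filter b)) Some by [].
have SomeC : continuous (Some : N_min -> N_adj_min (parity_filter b)).
  by apply/continuousP => A _; exact: discrete_open.
have [h [_ ch hi]] := iU _ _ (@AH_complete_N_adj_min _) SomeM SomeC.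
by exists h.
Qed.

Lemma no_universal_max (X : topSemigroupType) (i : N_max -> X) :
  ~ universal_AH_completion i.
Proof.
move=> [iAH iU]; have iH := AH_completion_H iAH; have [_ _ _ iD] := iH.
have [y ny] := H_completion_max_proper iH.
apply: (no_parity_extensions topsemigroup_hausdorff (dense_closure iD) ny) => b.
have SomeM : @homomorphism N_max (N_adj_max (parity_filter b)) Some by [].
have SomeC : continuous (Some : N_max -> N_adj_max (parity_filter b)).
  by apply/continuousP => A _; exact: discrete_open.
have [h [_ ch hi]] := iU _ _ (@AH_complete_N_adj_max _) SomeM SomeC.
by exists h.
Qed.

Theorem theorem2 :
  (* (i) *)
  (forall F : freeFilter,
     AH_complete (N_adj_min F : topSemilatticeType) /\
     AH_complete (N_adj_max F : topSemilatticeType)) /\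
  (* (ii) *)
  ((forall (X : topSemigroupType) (i : N_min -> X),
      H_completion i ->
      exists F : freeFilter, topologically_isomorphic X (N_adj_min F)) /\
   (forall (X : topSemigroupType) (i : N_max -> X),
      H_completion i ->
      exists F : freeFilter, topologically_isomorphic X (N_adj_max F))) /\
  (* (iii) *)
  (~ (exists (X : topSemigroupType) (i : N_min -> X),
        universal_AH_completion i) /\
   ~ (exists (X : topSemigroupType) (i : N_max -> X),
        universal_AH_completion i)).
Proof.
split; first by move=> F; split;
  [exact: AH_complete_N_adj_min|exact: AH_complete_N_adj_max].
split; split; [exact: H_completion_min|exact: H_completion_max| |].
- by move=> [X [i /no_universal_min]].
- by move=> [X [i /no_universal_max]].
Qed.
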